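(* Let $\mathbf S=\bigcup_{n\ge1}\mathbf S_n$ be the (disjoint) union of all symmetric groups, with the cross-order product $\odot$ defined for $\sigma\in\mathbf S_m$, $\mu\in\mathbf S_n$, $t=\mathrm{lcm}(m,n)$ by $$\sigma\odot\mu:=\varphi^m_t(\sigma)\circ\varphi^n_t(\mu)\in\mathbf S_t .$$ Then $(\mathbf S,\odot,\mathbf e)$ is a hyper group, where the identity set is $\mathbf e=\{e_n=\mathrm{Id}_n\in\mathbf S_n: n\ge 1\}$, indexed by the lattice of positive integers ordered by divisibility.
   Context: $\mathbf S_n$ is the group of permutations of $\{1,\dots,n\}$ under composition $\circ$. For $m\mid n$, $n=km$, the left embedding $\varphi^m_n:\mathbf S_m\to\mathbf S_n$ is defined by $\varphi^m_n(\sigma)((i-1)k+s):=(\sigma(i)-1)k+s$ for $1\le i\le m$, $1\le s\le k$. Hyper group: Let $(G,* )$ be a semigroup. A subset $\mathbf e\subset G$ is an identity set if (i) $g*e=e*g$ for all $g\in G$, $e\in\mathbf e$; (ii) $\mathbf e=\{e_\lambda:\lambda\in\Lambda\}$ is indexed without repetition by a lattice $(\Lambda,\le)$ and $e_\lambda*e_\mu=e_{\lambda\vee\mu}$; (iii) for each $g\in G$ there is a unique $e_g=e_{\lambda_g}\in\mathbf e$ such that for all $\lambda\in\Lambda$: $e_\lambda*g=g$ if and only if $\lambda\le\lambda_g$. A hyper group $(G,*,\mathbf e)$ is a semigroup with an identity set such that for each $g\in G$ there is $g^{-1}\in G$ with $g*g^{-1}=g^{-1}*g=e_g$. *)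

(* Defs.v *)
From HB Require Import structures.
From mathcomp Require Import all_boot all_order all_fingroup.
Set Implicit Arguments.
Unset Strict Implicit.
Unset Printing Implicit Defensive.
Import Order.TTheory.

Section HyperGroup.
Variables (G : Type) (op : G -> G -> G).
Variables (disp : Order.disp_t) (L : latticeType disp) (e : L -> G).

(* [l] is the index lambda_g of the local identity e_g of [g]. *)
Definition local_identity_index (g : G) (l : L) : Prop :=
  forall k : L, op (e k) g = g <-> (k <= l)%O.

(* [E] is an identity set whose indexing, without repetition, is [e]. *)
Record is_identity_set (E : G -> Prop) : Prop := IsIdentitySet {
  identity_central : forall g x, E x -> op g x = op x g;
  identity_indexed : forall x, E x <-> exists l, x = e l;
  identity_index_inj : injective e;
  identity_join : forall l k, op (e l) (e k) = e (l `|` k)%O;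
  identity_local : forall g,
    exists! eg, exists2 l, eg = e l & local_identity_index g l
}.

Record is_hyper_group (E : G -> Prop) : Prop := IsHyperGroup {
  hyper_group_assoc : associative op;
  hyper_group_identity_set : is_identity_set E;
  hyper_group_inverse : forall g, exists h, exists2 l,
    local_identity_index g l & op g h = e l /\ op h g = e l
}.

End HyperGroup.

(* [natdvd] also contains 0; the positive integers form a sublattice of it. *)
Definition is_posdvd : pred natdvd := fun n => 0 < n.

Record posdvd := PosDvd { posdvd_val : natdvd; _ : is_posdvd posdvd_val }.
Definition nat_of_posdvd (n : posdvd) : nat := posdvd_val n.
Coercion nat_of_posdvd : posdvd >-> nat.

HB.instance Definition _ := [isSub for posdvd_val].
HB.instance Definition _ := [Choice of posdvd by <:].

Lemma posdvd_meet_closed : Order.ClosedPredicates.meet_closed is_posdvd.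
Proof.
move=> m n m_gt0 n_gt0; suff: 0 < gcdn m n by [].
by rewrite gcdn_gt0; apply/orP; left.
Qed.

Lemma posdvd_join_closed : Order.ClosedPredicates.join_closed is_posdvd.
Proof.
move=> m n m_gt0 n_gt0; suff: 0 < lcmn m n by [].
by rewrite lcmn_gt0; apply/andP.
Qed.

HB.instance Definition _ := Order.SubChoice_isSubLattice.Build
  Order.dvd_display natdvd is_posdvd Order.dvd_display posdvd
  posdvd_meet_closed posdvd_join_closed.

Lemma posdvd_gt0 (n : posdvd) : 0 < n.
Proof. by case: n. Qed.

Lemma le_posdvdE (m n : posdvd) : (m <= n)%O = (m %| n).
Proof. by []. Qed.

Lemma join_posdvdE (m n : posdvd) : nat_of_posdvd (m `|` n)%O = lcmn m n.
Proof. by []. Qed.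

Definition lcm_posdvd (m n : posdvd) : posdvd :=
  @PosDvd (lcmn m n) (etrans (lcmn_gt0 m n)
                        (introT andP (conj (posdvd_gt0 m) (posdvd_gt0 n)))).

Section LeftEmbedding.
Variables (m n : nat) (dvd_mn : m %| n) (sigma : 'S_m).

Let k := n %/ m.

Lemma left_embed_quo_gt0 (j : 'I_n) : 0 < k.
Proof.
have n_gt0 : 0 < n := leq_ltn_trans (leq0n j) (ltn_ord j).
by rewrite divn_gt0 ?(dvdn_gt0 n_gt0 dvd_mn) // dvdn_leq.
Qed.

Lemma left_embed_div_subproof (j : 'I_n) : j %/ k < m.
Proof.
have k_gt0 := left_embed_quo_gt0 j.
by rewrite ltn_divLR // mulnC divnK.
Qed.

Lemma left_embed_fun_subproof (j : 'I_n) (i : 'I_m) : i * k + j %% k < n.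
Proof.
have k_gt0 := left_embed_quo_gt0 j.
rewrite -[X in _ < X](divnK dvd_mn) -/k [k * m]mulnC.
apply: (@leq_trans (i.+1 * k)); last by rewrite leq_mul2r ltn_ord orbT.
by rewrite mulSn addnC ltn_add2r ltn_mod.
Qed.

(* With indices shifted to start from 0, phi(sigma)(i * k + s) is
   sigma(i) * k + s for i < m and s < k; see [left_embedE]. *)
Definition left_embed_fun (j : 'I_n) : 'I_n :=
  Ordinal (left_embed_fun_subproof j
             (sigma (Ordinal (left_embed_div_subproof j)))).

Lemma left_embed_fun_inj : injective left_embed_fun.
Proof.
move=> j1 j2 /(congr1 val) /= eq_j.
have k_gt0 := left_embed_quo_gt0 j1.
have eq_mod : j1 %% k = j2 %% k.
  by have := congr1 (modn^~ k) eq_j; rewrite !modnMDl !modn_mod.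
move: eq_j; rewrite eq_mod => /addIn /eqP; rewrite eqn_pmul2r // => /eqP.
move=> /val_inj /perm_inj [] eq_div.
by apply: val_inj; rewrite /= (divn_eq j1 k) (divn_eq j2 k) eq_div eq_mod.
Qed.

Definition left_embed : 'S_n := perm left_embed_fun_inj.

Lemma left_embedE (i : 'I_m) (s : 'I_k) (j : 'I_n) :
  j = i * k + s :> nat -> left_embed j = sigma i * k + s :> nat.
Proof.
move=> def_j; have k_gt0 := left_embed_quo_gt0 j.
have mod_j : j %% k = s by rewrite def_j modnMDl modn_small.
have div_j : j %/ k = i by rewrite def_j divnMDl // divn_small ?addn0.
rewrite permE /= mod_j; congr (nat_of_ord (sigma _) * k + s).
exact: val_inj.
Qed.

End LeftEmbedding.

Definition all_perms : Type := {n : posdvd & 'S_n}.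

(* The product of [perm] composes left to right (see [permM]). *)
Definition perm_comp (n : nat) (sigma mu : 'S_n) : 'S_n := (mu * sigma)%g.

Lemma perm_compE (n : nat) (sigma mu : 'S_n) : perm_comp sigma mu =1 sigma \o mu.
Proof. exact: permM. Qed.

Definition cross_prod (sigma mu : all_perms) : all_perms :=
  Tagged (fun n : posdvd => 'S_n)
    (perm_comp
       (left_embed (dvdn_lcml (tag sigma) (tag mu)) (tagged sigma)
         : 'S_(lcm_posdvd (tag sigma) (tag mu)))
       (left_embed (dvdn_lcmr (tag sigma) (tag mu)) (tagged mu))).

Definition id_perm (n : posdvd) : all_perms :=
  Tagged (fun n : posdvd => 'S_n) (1%g : 'S_n).

Definition id_perms (x : all_perms) : Prop := exists n, x = id_perm n.

(* Main.v *)
Require Import Defs.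
From mathcomp Require Import all_boot all_order all_fingroup.
Set Implicit Arguments.
Unset Strict Implicit.
Unset Printing Implicit Defensive.
Import Order.TTheory.

(** The left embeddings make the symmetric groups a directed system over the
    divisibility lattice: each phi^m_n is a group morphism ([left_embed1],
    [left_embed_comp]), phi^n_n is the identity ([left_embed_refl]) and
    phi^t_u phi^m_t = phi^m_u ([left_embed_trans]), because the base-k expansion
    j = i * k + s that defines phi can be refined digit by digit.

    The hyper group laws follow formally.  Both bracketings of a triple product
    are the composite of the images of the three factors in the symmetric group
    whose order is their common lcm, whence associativity.  The product
    e_k (.) g has order lcm(k, n) for g in S_n, and it is the image of g there;
    it is thus g exactly when lcm(k, n) = n, i.e., when k divides n, so that the
    local identity of g is Id_n, and the inverse of g in the group S_n is an
    inverse for it.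

    Equal orders such as lcm(m, n) and lcm(n, m) index distinct types.
    [cross_prodE] takes care of this once and for all, by computing a product
    in the symmetric group of any order equal to the lcm. *)

Section LeftEmbedTheory.
Variables (m n : nat) (dvd_mn : m %| n).

Lemma left_embed_digits (j : 'I_n) :
  exists (i : 'I_m) (s : 'I_(n %/ m)), j = i * (n %/ m) + s :> nat.
Proof.
have k_gt0 := left_embed_quo_gt0 dvd_mn j.
exists (Ordinal (left_embed_div_subproof dvd_mn j)).
by exists (Ordinal (ltn_pmod j k_gt0)); apply: divn_eq.
Qed.

Lemma left_embed1 : left_embed dvd_mn 1 = 1%g.
Proof.
apply/permP=> j; apply: val_inj; have [i [s def_j]] := left_embed_digits j.
by rewrite /= (left_embedE dvd_mn _ def_j) !perm1 def_j.
Qed.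

Lemma left_embed_comp (sigma mu : 'S_m) :
  left_embed dvd_mn (perm_comp sigma mu) =
  perm_comp (left_embed dvd_mn sigma) (left_embed dvd_mn mu).
Proof.
apply/permP=> j; apply: val_inj; have [i [s def_j]] := left_embed_digits j.
rewrite /= (left_embedE dvd_mn _ def_j) !perm_compE /=.
by rewrite (left_embedE dvd_mn _ (left_embedE dvd_mn mu def_j)).
Qed.

End LeftEmbedTheory.

Lemma left_embed_refl (n : nat) (dvd_nn : n %| n) (sigma : 'S_n) :
  left_embed dvd_nn sigma = sigma.
Proof.
apply/permP=> j; apply: val_inj.
have n_gt0 := leq_ltn_trans (leq0n j) (ltn_ord j).
have k1 : n %/ n = 1 by rewrite divnn n_gt0.
have k_gt0 : 0 < n %/ n by rewrite k1.
have def_j : j = j * (n %/ n) + Ordinal k_gt0 :> nat.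
  by rewrite /= k1 muln1 addn0.
by rewrite /= (left_embedE dvd_nn _ def_j) /= k1 muln1 addn0.
Qed.

(** Writing j = a * (u / t) + r with a = i * (t / m) + s, both sides keep the
    digits s and r, and replace i by sigma i. *)
Lemma left_embed_trans (m t u : nat) (dvd_mt : m %| t) (dvd_tu : t %| u)
    (dvd_mu : m %| u) (sigma : 'S_m) :
  left_embed dvd_tu (left_embed dvd_mt sigma) = left_embed dvd_mu sigma.
Proof.
apply/permP=> j; apply: val_inj => /=.
have [a [r def_j]] := left_embed_digits dvd_tu j.
have [i [s def_a]] := left_embed_digits dvd_mt a.
have t_gt0 : 0 < t := leq_ltn_trans (leq0n a) (ltn_ord a).
have quoM : u %/ m = (t %/ m) * (u %/ t).
  by rewrite mulnC muln_divA // divnK.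
have lt_sr : s * (u %/ t) + r < u %/ m.
  rewrite quoM; apply: (@leq_trans (s.+1 * (u %/ t))).
    by rewrite mulSn addnC ltn_add2r.
  by rewrite leq_mul2r ltn_ord orbT.
(* The offset of j in its block of size u / m has the digits s and r. *)
have def_j_mu : j = i * (u %/ m) + Ordinal lt_sr :> nat.
  by rewrite def_j def_a /= quoM mulnDl mulnA addnA.
rewrite (left_embedE dvd_tu _ def_j) (left_embedE dvd_mt _ def_a).
by rewrite (left_embedE dvd_mu _ def_j_mu) /= quoM mulnDl mulnA addnA.
Qed.

Notation perm_of_order sigma := (Tagged (fun n : posdvd => 'S_n) sigma).

(** Leaving [t] and the divisibility proofs free avoids transports between
    symmetric groups whose orders are equal, but not convertible. *)
Lemma cross_prodE (x y : all_perms) (t : posdvd)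
    (dvd_xt : tag x %| t) (dvd_yt : tag y %| t) :
  t = lcmn (tag x) (tag y) :> nat ->
  cross_prod x y =
  perm_of_order (perm_comp (left_embed dvd_xt (tagged x))
                           (left_embed dvd_yt (tagged y)) : 'S_t).
Proof.
move=> def_t; have {}def_t : t = lcm_posdvd (tag x) (tag y) by apply: val_inj.
subst t; rewrite /cross_prod.
by rewrite (bool_irrelevance dvd_xt (dvdn_lcml _ _))
           (bool_irrelevance dvd_yt (dvdn_lcmr _ _)).
Qed.

Lemma cross_prod_same (n : posdvd) (sigma mu : 'S_n) :
  cross_prod (perm_of_order sigma) (perm_of_order mu) =
  perm_of_order (perm_comp sigma mu).
Proof.
rewrite (@cross_prodE (perm_of_order sigma) (perm_of_order mu) n
           (dvdnn n) (dvdnn n)).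
  by rewrite !left_embed_refl.
exact/esym/lcmn_idPr/dvdnn.
Qed.

Lemma cross_prod_idl (k : posdvd) (x : all_perms) (t : posdvd)
    (dvd_xt : tag x %| t) :
  t = lcmn k (tag x) :> nat ->
  cross_prod (id_perm k) x =
  perm_of_order (left_embed dvd_xt (tagged x) : 'S_t).
Proof.
move=> def_t; have dvd_kt : k %| t by rewrite def_t dvdn_lcml.
rewrite (@cross_prodE (id_perm k) x t dvd_kt dvd_xt) //=.
by rewrite left_embed1 /perm_comp mulg1.
Qed.

Lemma cross_prod_idr (k : posdvd) (x : all_perms) (t : posdvd)
    (dvd_xt : tag x %| t) :
  t = lcmn (tag x) k :> nat ->
  cross_prod x (id_perm k) =
  perm_of_order (left_embed dvd_xt (tagged x) : 'S_t).
Proof.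
move=> def_t; have dvd_kt : k %| t by rewrite def_t dvdn_lcmr.
rewrite (@cross_prodE x (id_perm k) t dvd_xt dvd_kt) //=.
by rewrite left_embed1 /perm_comp mul1g.
Qed.

Lemma cross_prodA : associative cross_prod.
Proof.
move=> x y z; set tyz := lcm_posdvd (tag y) (tag z).
set txy := lcm_posdvd (tag x) (tag y); set u := lcm_posdvd (tag x) tyz.
have dvd_xu : tag x %| u by apply: dvdn_lcml.
have dvd_yzu : tyz %| u by apply: dvdn_lcmr.
have dvd_yu : tag y %| u := dvdn_trans (dvdn_lcml _ _) dvd_yzu.
have dvd_zu : tag z %| u := dvdn_trans (dvdn_lcmr _ _) dvd_yzu.
have dvd_xyu : txy %| u by rewrite dvdn_lcm dvd_xu.
rewrite (@cross_prodE x (cross_prod y z) u dvd_xu dvd_yzu) //.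
rewrite (@cross_prodE (cross_prod x y) z u dvd_xyu dvd_zu); last exact: lcmnA.
rewrite /= !left_embed_comp (left_embed_trans _ _ dvd_xu).
rewrite !(left_embed_trans _ _ dvd_yu) (left_embed_trans _ _ dvd_zu).
by rewrite /perm_comp mulgA.
Qed.

Lemma cross_prod_id_central (x : all_perms) (k : posdvd) :
  cross_prod x (id_perm k) = cross_prod (id_perm k) x.
Proof.
have dvd_xt : tag x %| lcm_posdvd (tag x) k := dvdn_lcml _ _.
by rewrite (cross_prod_idr dvd_xt) // (cross_prod_idl dvd_xt) //= lcmnC.
Qed.

(** Comparing orders in e_k (.) g = g gives one direction; in the other one,
    e_k (.) g is the image of g under the embedding of its own group. *)
Lemma local_identity_index_tag (g : all_perms) :
  local_identity_index cross_prod id_perm g (tag g).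
Proof.
move=> k; rewrite le_posdvdE; split=> [eq_g | dvd_kg].
  have /(congr1 nat_of_posdvd) /= <- := congr1 tag eq_g; exact: dvdn_lcml.
have def_t : tag g = lcmn k (tag g) :> nat by apply/esym/lcmn_idPr.
by rewrite (cross_prod_idl (dvdnn (tag g)) def_t) left_embed_refl taggedK.
Qed.

Lemma id_perms_identity_set :
  @is_identity_set all_perms cross_prod Order.dvd_display posdvd id_perm id_perms.
Proof.
split=> [g _ [k ->] | // | k l | k l | g].
- exact: cross_prod_id_central.
- exact: (congr1 tag).
- have dvd_lt : l %| (k `|` l)%O by apply: dvdn_lcmr.
  by rewrite (@cross_prod_idl k (id_perm l) _ dvd_lt) //= left_embed1.
exists (id_perm (tag g)); split.
  by exists (tag g) => //; apply: local_identity_index_tag.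
(* An index l of g satisfies e_l (.) g = g, as l is below itself, so it is below
   any other index of g; antisymmetry then gives uniqueness. *)
move=> _ [l -> idx_l]; congr id_perm; apply: le_anti.
apply/andP; split.
  by apply/idx_l/local_identity_index_tag.
by apply/local_identity_index_tag/idx_l.
Qed.

Theorem theorem4p7 :
  @is_hyper_group all_perms cross_prod Order.dvd_display posdvd id_perm id_perms.
Proof.
split; [exact: cross_prodA | exact: id_perms_identity_set | case=> n sigma].
exists (perm_of_order (sigma^-1)%g), n.
  exact: (local_identity_index_tag (perm_of_order sigma)).
by rewrite !cross_prod_same /perm_comp mulVg mulgV.
Qed.
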